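(* Let $p\in[1,\infty)$ be real. For any matrix $G\in\mathbb{R}^{m\times n}$ with (thin) singular value decomposition $G = U\Sigma V^T$ and polar factor $P = UV^T$, and for every finite $\alpha>0$ with $\alpha \ge \|G\|_2$, $$U\Sigma^{1/p}V^T = \alpha^{1/p}\sum_{i=0}^{\infty}\binom{1/p}{i}\left(\frac1\alpha\, G P^T - I\right)^i P,$$ where $\sum_{i=0}^{\infty}\binom{1/p}{i}\left(\frac1\alpha GP^T - I\right)^iP$ is a convergent series of $m\times n$ matrices.
   Context: Thin SVD: with $s=\min(m,n)$, $U\in\mathbb{R}^{m\times s}$ and $V\in\mathbb{R}^{n\times s}$ have orthonormal columns and $\Sigma = \operatorname{diag}(\sigma_1,\dots,\sigma_s)$ with $\sigma_j\ge0$; $\Sigma^{1/p}=\operatorname{diag}(\sigma_1^{1/p},\dots,\sigma_s^{1/p})$. $\|G\|_2$ is the spectral norm (largest singular value), $I$ is the $m\times m$ identity, $X^0=I$, and $\binom{a}{i} = \frac{a(a-1)\cdots(a-i+1)}{i!}$ is the generalized binomial coefficient, with $\binom{a}{0}=1$. *)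

(* Defs.v *)
From HB Require Import structures.
From mathcomp Require Import all_boot all_order all_algebra.
From mathcomp Require Import all_classical all_reals all_analysis.
Set Implicit Arguments.
Unset Strict Implicit.
Unset Printing Implicit Defensive.

Import Order.TTheory GRing.Theory Num.Theory.
Import numFieldNormedType.Exports.
Local Open Scope classical_set_scope.
Local Open Scope ring_scope.

Definition orthonormal_cols (R : realType) (m s : nat) (U : 'M[R]_(m, s)) :
    Prop :=
  U^T *m U = 1%:M.

(* The row vector sigma lists the diagonal of Sigma; as usual for a thin SVD
   without further normalization, no ordering of the sigma_j is imposed. *)
Definition is_thin_svd (R : realType) (m n : nat) (G : 'M[R]_(m, n))
    (U : 'M[R]_(m, minn m n)) (sigma : 'rV[R]_(minn m n))
    (V : 'M[R]_(n, minn m n)) : Prop :=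
  [/\ orthonormal_cols U, orthonormal_cols V,
      forall j, 0 <= sigma 0 j
    & G = U *m diag_mx sigma *m V^T].

Definition singular_values (R : realType) (m n : nat) (G : 'M[R]_(m, n)) :
    set R :=
  [set x | exists U sigma V, is_thin_svd G U sigma V /\
     exists j, x = sigma 0 j].

(* The singular values form a finite set, so this supremum is the largest one;
   it is 0 when m = 0 or n = 0 (sup set0 = 0). *)
Definition spectral_norm (R : realType) (m n : nat) (G : 'M[R]_(m, n)) : R :=
  sup (singular_values G).

Definition gbinom (R : realType) (a : R) (i : nat) : R :=
  (\prod_(j < i) (a - j%:R)) / i`!%:R.

(* sigma_j ^ (1/p) on the diagonal; for p != 0, powR maps 0 to 0. *)
Definition diag_root (R : realType) (s : nat) (p : R) (sigma : 'rV[R]_s) :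
    'M[R]_s :=
  diag_mx (\row_j (sigma 0 j `^ p^-1)).

Definition polar_term (R : realType) (m n : nat) (p alpha : R)
    (G P : 'M[R]_(m, n)) (i : nat) : 'M[R]_(m, n) :=
  gbinom p^-1 i *: ((alpha^-1 *: (G *m P^T) - 1%:M) ^+ i *m P).

(* Main.v *)
(* Since U^T U = V^T V = I, the matrix X = G P^T / alpha - I satisfies
   X U = U diag (sigma_j / alpha - 1), so everything reduces to the scalar
   binomial series of (1 + x)^a, a = 1/p in (0, 1], for x in [-1, 0].  For
   x > -1 the partial sums almost solve the differential equation of
   (1 + x)^a, and the mean value theorem bounds the error geometrically.  The
   endpoint x = -1 (a vanishing sigma_j) needs no Abel-type theorem: all
   coefficients but the first alternate with a fixed sign, so there the partial
   sums are nonnegative and below those at any x in [-1, 0], whose limits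
   (1 + x)^a tend to 0 as x tends to -1. *)

Require Import Defs.
From HB Require Import structures.
From mathcomp Require Import all_boot all_order all_algebra.
From mathcomp Require Import all_classical all_reals all_analysis.
From mathcomp Require Import ring lra.
Import Order.TTheory GRing.Theory Num.Theory.
Import numFieldNormedType.Exports.
Local Open Scope classical_set_scope.
Local Open Scope ring_scope.

Set Implicit Arguments.
Unset Strict Implicit.
Unset Printing Implicit Defensive.

(** * Scalar binomial series *)

Lemma gbinom0 (R : realType) (a : R) : gbinom a 0 = 1.
Proof. by rewrite /gbinom big_ord0 divr1. Qed.

Lemma gbinomS (R : realType) (a : R) (n : nat) :
  n.+1%:R * gbinom a n.+1 = (a - n%:R) * gbinom a n.
Proof.
have h1 : n.+1%:R != 0 :> R by rewrite pnatr_eq0.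
have h2 : n`!%:R != 0 :> R by rewrite pnatr_eq0 -lt0n fact_gt0.
rewrite /gbinom big_ord_recr factS natrM /=.
by move: h1 h2; move: n.+1%:R n`!%:R => s f h1 h2; field; rewrite h1 h2.
Qed.

Definition binom_poly (R : realType) (a : R) (n : nat) : {poly R} :=
  \sum_(i < n) gbinom a i *: 'X^i.

Lemma binom_polyS (R : realType) (a : R) (n : nat) :
  binom_poly a n.+1 = binom_poly a n + gbinom a n *: 'X^n.
Proof. exact: big_ord_recr. Qed.

Lemma binom_poly1 (R : realType) (a : R) : binom_poly a 1 = 1.
Proof. by rewrite /binom_poly big_ord1 gbinom0 scale1r. Qed.

Lemma horner_binom_poly (R : realType) (a x : R) (n : nat) :
  (binom_poly a n).[x] = \sum_(i < n) gbinom a i * x ^+ i.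
Proof.
by rewrite horner_sum; apply: eq_bigr => i _; rewrite hornerZ hornerXn.
Qed.

(* (1 + x)^a solves (1 + x) y' = a y; a partial sum of its binomial series
   does so up to one monomial. *)
Lemma binom_poly_ode (R : realType) (a x : R) (n : nat) :
  (1 + x) * (binom_poly a n.+1)^`().[x] - a * (binom_poly a n.+1).[x] =
  - ((a - n%:R) * gbinom a n) * x ^+ n.
Proof.
elim: n => [|n IH].
  by rewrite binom_poly1 -polyC1 derivC !hornerC gbinom0; ring.
rewrite binom_polyS derivD derivZ derivXn !hornerD !hornerZ hornerMn !hornerXn.
rewrite -gbinomS in IH.
transitivity ((1 + x) * (binom_poly a n.+1)^`().[x] -
    a * (binom_poly a n.+1).[x] +
    gbinom a n.+1 * (((1 + x) * (x ^+ n *+ n.+1)) - a * x ^+ n.+1)).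
  by rewrite /=; ring.
rewrite IH /= -mulr_natr exprS; ring.
Qed.

(** By [gbinomS], consecutive quantities differ by the factor (a - (n+1)) / (n+1), of absolute value
    at most 1. This bounds the defect in [binom_poly_ode] uniformly in n. *)
Lemma gbinom_step_le1 (R : realType) (a : R) (n : nat) : 0 <= a <= 1 ->
  `|(a - n%:R) * gbinom a n| <= 1.
Proof.
move=> /andP[a0 a1]; elim: n => [|n IH].
  by rewrite gbinom0 subr0 mulr1 ger0_norm.
apply: le_trans IH; rewrite -[in leRHS]gbinomS !normrM ler_wpM2r//.
rewrite ler0_norm ?opprB ?ger0_norm//; last first.
  by rewrite subr_le0 (le_trans a1)// ler1n.
by rewrite lerBlDr lerDl.
Qed.

(** The coefficient of index 1 is a >= 0, and each further factor a - k with k >= 1 flips the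
    sign. *)
Lemma gbinom_alternating (R : realType) (a : R) (n : nat) : 0 <= a <= 1 ->
  gbinom a n.+1 * (-1) ^+ n.+1 <= 0.
Proof.
move=> /andP[a0 a1]; elim: n => [|n IH].
  have := gbinomS a 0; rewrite gbinom0 subr0 mulr1 mul1r => ->.
  by rewrite expr1 mulrN1 oppr_le0.
have n0 : 0 < n.+2%:R :> R by rewrite ltr0n.
rewrite -(pmulr_rle0 _ n0) mulrA gbinomS exprS.
rewrite mulN1r mulrN -mulNr -mulNr opprB -mulrA.
by rewrite mulr_ge0_le0// subr_ge0 (le_trans a1)// ler1n.
Qed.

(** At -1 the derivative term of [binom_poly_ode] vanishes, which leaves a closed form for the
    partial sum: a single coefficient of known sign. *)
Lemma binom_poly_N1_ge0 (R : realType) (a : R) (n : nat) : 0 < a <= 1 ->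
  0 <= (binom_poly a n).[-1].
Proof.
move=> /andP[a0 a1]; case: n => [|n]; first by rewrite horner_binom_poly big_ord0.
have := binom_poly_ode a (-1) n.
rewrite subrr mul0r sub0r -gbinomS mulNr => /oppr_inj.
rewrite -(pmulr_rge0 _ a0) => ->.
have := @gbinom_alternating R a n; rewrite (ltW a0) a1 => /(_ isT).
by rewrite exprS mulN1r mulrN oppr_le0 => h; rewrite -mulrA mulr_ge0.
Qed.

(** Termwise: for i >= 1 the term at -1 is nonpositive, and passing to x multiplies it by (-x)^i,
    which lies in [0, 1]. *)
Lemma binom_poly_N1_le (R : realType) (a x : R) (n : nat) : 0 < a <= 1 ->
  -1 <= x <= 0 -> (binom_poly a n).[-1] <= (binom_poly a n).[x].
Proof.
move=> /andP[a0 a1] /andP[x1 x0]; rewrite !horner_binom_poly.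
apply: ler_sum => -[[|i] /= _] _; first by rewrite !expr0.
have -> : x ^+ i.+1 = (-1) ^+ i.+1 * (- x) ^+ i.+1.
  by rewrite -exprMn mulN1r opprK.
rewrite [leRHS]mulrA.
have [h0 h1] : 0 <= - x /\ - x <= 1 by split; lra.
rewrite -[leLHS]mulr1 ler_wnM2l ?gbinom_alternating ?(ltW a0)//.
by rewrite exprn_ile1.
Qed.

(* Mean value theorem for S(x) (1 + x)^-a, whose derivative is controlled by
   the defect of the differential equation. *)
Lemma binom_poly_error (R : realType) (a x : R) (n : nat) : 0 < a <= 1 ->
  -1 < x <= 0 ->
  `|(binom_poly a n.+1).[x] - (1 + x) `^ a| <= (1 + x)^-1 * `|x| ^+ n.
Proof.
move=> /andP[a0 a1] /andP[x1 x0].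
pose S := binom_poly a n.+1.
pose f : R -> R := (fun y => S.[y]) * (fun y => (1 + y) `^ (- a)).
pose df y := - ((a - n%:R) * gbinom a n) * y ^+ n * (1 + y) `^ (- a - 1).
have y1 y : x <= y -> 0 < 1 + y by move=> ?; lra.
have dfE y : x <= y -> is_derive y 1 f (df y).
  move=> /y1 y10.
  have D1 : is_derive y 1 (fun y => 1 + y) (0 + 1) by apply: is_deriveD.
  have D2 := is_derive1_powR (- a) y10.
  have D3 : is_derive y 1 (fun y => (1 + y) `^ (- a))
      (- a * (1 + y) `^ (- a - 1) * (0 + 1)).
    exact: is_derive1_comp.
  apply: (is_derive_eq (is_deriveM _ D3)).
  rewrite /df -binom_poly_ode -/S -![_ *: _]/(_ * _).
  (* Pulling out (1 + y)^(-a - 1) leaves the left side of [binom_poly_ode]. *)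
  rewrite (_ : (1 + y) `^ (- a) = (1 + y) * (1 + y) `^ (- a - 1)); last first.
    rewrite [RHS]mulrC -[X in _ * X]powRr1 ?ltW// -powRD ?subrK//.
    by rewrite (gt_eqF y10) implybT.
  by ring.
have [||c /andP[xc c0]] := @MVT_segment R f df x 0 x0.
- by move=> y /andP[/= xy _]; apply: dfE; exact: ltW.
- apply: derivable_within_continuous => y; rewrite in_itv/= => /andP[xy _].
  by have := dfE y xy => ?; exact: ex_derive.
rewrite !bnd_simp in xc c0.
have f0 : f 0 = 1.
  rewrite /f fctE /= addr0 powR1 mulr1 horner_binom_poly big_ord_recl expr0.
  by rewrite gbinom0 mulr1 big1 ?addr0// => i _; rewrite exprS mul0r mulr0.
have y0 := y1 _ (lexx x).
have -> : S.[x] - (1 + x) `^ a = - ((1 + x) `^ a * (f 0 - f x)).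
  rewrite f0 /f fctE mulrBr mulr1 opprB mulrCA -powRD.
    by rewrite subrr powRr0 mulr1.
  by rewrite (gt_eqF y0) implybT.
move=> ->; rewrite sub0r normrN /df !normrM !normrN -normrM.
rewrite (ger0_norm (powR_ge0 _ _)) (ger0_norm (powR_ge0 (1 + c) _)).
(* After cancelling (1 + x)^a, only the derivative at c remains to be bounded; the negative power is
   largest at the left end x. *)
have -> : (1 + x)^-1 = (1 + x) `^ a * (1 + x) `^ (- a - 1).
  rewrite -powRD ?(gt_eqF y0) ?implybT// addrA subrr sub0r powR_inv1//.
  exact: ltW.
rewrite -[leRHS]mulrA ler_wpM2l ?powR_ge0//.
have hc : (1 + c) `^ (- a - 1) <= (1 + x) `^ (- a - 1).
  rewrite -opprD !powRN lef_pV2 ?posrE ?powR_gt0 ?y1//.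
  by rewrite ge0_ler_powR ?nnegrE ?lerD2l//; have := y1 c xc; lra.
have xn : `|c| ^+ n <= `|x| ^+ n.
  by rewrite lerXn2r ?nnegrE// !ler0_norm// lerN2.
have gn : `|(a - n%:R) * gbinom a n * c ^+ n| <= `|x| ^+ n.
  rewrite normrM normrX -[leRHS]mul1r ler_pM ?exprn_ge0//.
  by rewrite gbinom_step_le1// (ltW a0).
(* The interval length |x| is at most 1 and is dropped. *)
apply: (@le_trans _ _
  (`|(a - n%:R) * gbinom a n * c ^+ n| * (1 + c) `^ (- a - 1))).
  by rewrite ler_piMr ?mulr_ge0 ?powR_ge0// ler0_norm//; lra.
by rewrite mulrC ler_pM ?powR_ge0.
Qed.

Lemma cvg_binom_poly (R : realType) (a x : R) : 0 < a <= 1 -> -1 <= x <= 0 ->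
  (binom_poly a n).[x] @[n --> \oo] --> (1 + x) `^ a.
Proof.
move=> a01 /andP[x1 x0]; have a0 : 0 < a by case/andP: a01.
have inner y : -1 < y <= 0 -> (binom_poly a n).[y] @[n --> \oo] --> (1 + y) `^ a.
  move=> /andP[y1 y0]; rewrite -cvg_shiftS /=; apply/cvgrPdist_le => e e0.
  have /cvgr_norm_le/(_ e) : geometric (1 + y)^-1 `|y| @ \oo --> 0.
    by apply: cvg_geometric; rewrite normr_id ler0_norm; lra.
  rewrite normr0 => /(_ e0); apply: filterS => n /=.
  rewrite ger0_norm; last first.
    by rewrite mulr_ge0 ?exprn_ge0// invr_ge0; lra.
  by rewrite distrC; apply: le_trans; rewrite binom_poly_error// y1 y0.
move: x1; rewrite le_eqVlt => /predU1P[<-|x1]; last by apply: inner; rewrite x1.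
rewrite subrr powR0 ?gt_eqF//; apply/cvgrPdist_lt => e e0.
(* The partial sums at -1 are compared with those at d - 1, whose limit is d^a < e. *)
near (0 : R)^'+ => d.
have d0 : 0 < d by near: d; exact: nbhs_right_gt.
have d1 : d <= 1 by near: d; exact: nbhs_right_le.
have de : d `^ a < e by near: d; exact: (cvgr_lt _ (powR_cvg0 a0)).
have d10 : -1 < d - 1 <= 0 by apply/andP; split; lra.
have : \forall n \near \oo, (binom_poly a n).[d - 1] < e.
  by have := inner _ d10; rewrite (addrC 1) subrK => /cvgr_lt; exact.
apply: filterS => n; apply: le_lt_trans.
rewrite sub0r normrN ger0_norm ?binom_poly_N1_ge0//.
by rewrite binom_poly_N1_le//; case/andP: d10 => /ltW -> ->.
Unshelve. all: by end_near. Qed.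

(** * Matrix limits, singular values and reduction to scalars *)

Lemma cvg_mx (R : realType) (m n : nat) (u : nat -> 'M[R]_(m, n))
    (M : 'M[R]_(m, n)) :
  (forall i j, u k i j @[k --> \oo] --> M i j) -> u @ \oo --> M.
Proof.
move=> uM; apply/cvg_ballP => e e0.
have : \forall k \near \oo, forall i j, ball (M i j) e (u k i j).
  apply: filter_forall => i; apply: filter_forall => j.
  by have /cvg_ballP := uM i j; exact.
by apply: filterS => k.
Qed.

Lemma cvg_mx_lim (R : realType) (m n : nat) (u : nat -> 'M[R]_(m, n))
    (M : 'M[R]_(m, n)) : u @ \oo --> M -> limn u = M.
Proof.
move=> uM; apply/matrixP => i j.
have h (L : 'M[R]_(m, n)) : u @ \oo --> L -> u k i j @[k --> \oo] --> L i j.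
  move=> uL.
  exact: (cvg_comp u (fun M : 'M[R]_(m, n) => M i j) uL
    (@coord_continuous _ _ _ i j L)).
have /h limu : cvgn u by apply: cvgP uM.
exact: (cvg_unique _ limu (h _ uM)).
Qed.

(** The trace is the sum of the squared singular values, and t <= 1 + t^2. The bound does not depend
    on the decomposition, so the supremum in [spectral_norm] is over a bounded set. *)
Lemma thin_svd_sigma_le (R : realType) (m n : nat) (G : 'M[R]_(m, n)) U sigma V j :
  is_thin_svd G U sigma V -> sigma 0 j <= 1 + \tr (G^T *m G).
Proof.
move=> [hU hV s0 ->].
rewrite /orthonormal_cols in hU hV.
rewrite !trmx_mul trmxK tr_diag_mx -!mulmxA mxtrace_mulC -!mulmxA hV mulmx1.
rewrite (mulmxA U^T) hU mul1mx mulmx_diag mxtrace_diag.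
have h : sigma 0 j ^+ 2 <= \sum_i (\row_k (sigma 0 k * sigma 0 k)) 0 i.
  rewrite (bigD1 j)//= mxE -expr2 lerDl sumr_ge0// => i _.
  by rewrite mxE mulr_ge0.
apply: le_trans (lerD (lexx 1) h).
have := s0 j; nra.
Qed.

Lemma thin_svd_le_spectral_norm (R : realType) (m n : nat) (G : 'M[R]_(m, n))
    U sigma V j :
  is_thin_svd G U sigma V -> sigma 0 j <= spectral_norm G.
Proof.
move=> h; apply: ub_le_sup; last by exists U, sigma, V; split=> //; exists j.
exists (1 + \tr (G^T *m G)) => _ [U' [s' [V' [h' [i ->]]]]].
exact: thin_svd_sigma_le h'.
Qed.

(** The matrix X maps the column space of U to itself, so X U = U D with D diagonal, whence X^i U =
    U D^i by induction; U need not be square. *)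
Lemma polar_term_svd (R : realType) (m n : nat) (p alpha : R)
    (G : 'M[R]_(m, n)) U sigma V i : is_thin_svd G U sigma V ->
  polar_term p alpha G (U *m V^T) i =
  U *m diag_mx (\row_j (gbinom p^-1 i * (alpha^-1 * sigma 0 j - 1) ^+ i)) *m V^T.
Proof.
move=> [hU hV _ ->]; rewrite /orthonormal_cols in hU hV.
rewrite /polar_term trmx_mul trmxK.
have -> : U *m diag_mx sigma *m V^T *m (V *m U^T) = U *m diag_mx sigma *m U^T.
  by rewrite -!mulmxA (mulmxA V^T) hV mul1mx.
set X := _ - _.
have XU : X *m U = U *m diag_mx (\row_j (alpha^-1 * sigma 0 j - 1)).
  rewrite mulmxBl -scalemxAl -!mulmxA hU mulmx1 mul1mx.
  apply/matrixP => k l; rewrite !mul_mx_diag !mxE; ring.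
have XiU : X ^+ i *m U = U *m diag_mx (\row_j ((alpha^-1 * sigma 0 j - 1) ^+ i)).
  elim: i => [|i IH].
    rewrite expr0 mul1mx; apply/matrixP => k l.
    by rewrite mul_mx_diag !mxE mulr1.
  rewrite exprSr -mulmxA XU mulmxA IH -mulmxA mulmx_diag; congr (_ *m diag_mx _).
  by apply/rowP => k; rewrite !mxE exprSr.
rewrite mulmxA XiU scalemxAl scalemxAr -linearZ; congr (_ *m diag_mx _ *m _).
by apply/rowP => k; rewrite !mxE.
Qed.

Theorem proposition3 (R : realType) (p : R) (hp : 1 <= p)
  (m n : nat) (G : 'M[R]_(m, n))
  (U : 'M[R]_(m, minn m n)) (sigma : 'rV[R]_(minn m n))
  (V : 'M[R]_(n, minn m n)) (hsvd : is_thin_svd G U sigma V)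
  (P : 'M[R]_(m, n)) (hP : P = U *m V^T)
  (alpha : R) (halpha0 : 0 < alpha) (halpha : spectral_norm G <= alpha) :
  cvgn (series (polar_term p alpha G P)) /\
  U *m diag_root p sigma *m V^T =
    alpha `^ p^-1 *: limn (series (polar_term p alpha G P)).
Proof.
pose x j := alpha^-1 * sigma 0 j - 1.
have s0 j : 0 <= sigma 0 j by case: hsvd.
have x10 j : -1 <= x j <= 0.
  have : alpha^-1 * sigma 0 j <= 1.
    rewrite mulrC ler_pdivrMr// mul1r (le_trans _ halpha)//.
    exact: thin_svd_le_spectral_norm hsvd.
  have : 0 <= alpha^-1 * sigma 0 j by rewrite mulr_ge0// invr_ge0 ltW.
  by rewrite /x; lra.
have p01 : 0 < p^-1 <= 1 by rewrite invr_gt0 invf_le1// ?(lt_le_trans ltr01 hp).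
pose L := U *m diag_mx (\row_j ((1 + x j) `^ p^-1)) *m V^T.
have SL : series (polar_term p alpha G P) @ \oo --> L.
  apply: cvg_mx => i j.
  (* Each entry is a fixed finite linear combination of scalar partial sums at the points [x l]. *)
  have -> : (fun k => series (polar_term p alpha G P) k i j) =
            (fun k => \sum_l (U i l * (binom_poly p^-1 k).[x l] * V j l)).
    apply/funext => k; rewrite seriesEord hP summxE.
    under eq_bigr do rewrite (polar_term_svd _ _ _ hsvd) mul_mx_diag mxE.
    rewrite exchange_big; apply: eq_bigr => l _ /=.
    rewrite horner_binom_poly mulr_sumr mulr_suml.
    by apply: eq_bigr => q _; rewrite !mxE.
  have -> : L i j = \sum_l (U i l * (1 + x l) `^ p^-1 * V j l).
    by rewrite mxE; apply: eq_bigr => l _; rewrite mul_mx_diag !mxE.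
  apply: cvg_big => [|l _]; first exact: add_continuous.
  apply: cvgM; last exact: cvg_cst.
  by apply: cvgM; [exact: cvg_cst | exact: cvg_binom_poly].
split; first by apply: cvgP SL.
rewrite (cvg_mx_lim SL) /L scalemxAl scalemxAr -linearZ /diag_root.
congr (_ *m diag_mx _ *m _); apply/rowP => j; rewrite !mxE.
(* Merging the powers gives the base alpha (1 + x_j) = sigma_j. *)
rewrite -powRM ?(ltW halpha0)//; last first.
  by rewrite /x addrC subrK mulr_ge0// invr_ge0 ltW.
by rewrite /x addrC subrK mulrA divff ?gt_eqF// mul1r.
Qed.
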